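(* Let $(H,\mathcal B,\mu_1)$ be an abelian normalizable hypergroup such that $G\widehat{(H,\mathcal B,\mu_1)}$ is a finite group. Then $(H,\mathcal B)$ is dual-Burnside if and only if $$\Big(\prod_{i=1}^m\frac{x_i}{d_i}\Big)^2=\frac{|G\widehat{(H,\mathcal B,\mu_1)}|}{n(H,\mathcal B,\mu_1)}\Big(\sum_{i\in\mathcal I_{G\widehat{(H,\mathcal B,\mu_1)}}}h_i\,d_{i^*}\,x_i\Big).$$
   Context: Hypergroup: a finite-dimensional unital associative $\mathbb C$-algebra $H$ with a $\mathbb C$-basis $\mathcal B=\{x_1=1,\dots,x_m\}$, $x_ix_j=\sum_kN_{i,j}^kx_k$, $N_{i,j}^k\in\mathbb C$, and an involution $i\mapsto i^*$ of $\mathcal I=\{1,\dots,m\}$ such that $N_{i,i^*}^1>0$ and $N_{i,j}^1=0$ if $j\ne i^*$. Standing assumption: the involution $x_i\mapsto x_i^*:=x_{i^*}$ extends (conjugate-linearly) to an anti-involution of $H$, i.e. $N_{j^*,i^*}^{k^*}=\overline{N_{i,j}^k}$, so $H$ is a $*$-algebra (hence semisimple), and if $H$ is commutative then $\mu(x_{i^*})=\overline{\mu(x_i)}$ for every algebra morphism $\mu:H\to\mathbb C$. Put $h_i:=1/N_{i,i^*}^1$. Abelian means $H$ commutative. Let $(H,\mathcal B)$ be abelian. $\widehat{\mathcal B}=\{\mu_1,\dots,\mu_m\}$ is the set of all unital algebra morphisms $H\to\mathbb C$, a basis of $H^*$. An abelian normalizable hypergroup $(H,\mathcal B,\mu_1)$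 is an abelian hypergroup with a chosen $\mu_1\in\widehat{\mathcal B}$ such that $d_i:=\mu_1(x_i)\neq0$ for all $i$. Its order is $n(H,\mathcal B,\mu_1)=\sum_ih_i|d_i|^2$. Dual hypergroup $\widehat{(H,\mathcal B,\mu_1)}$: $H^*$ with basis $\widehat{\mathcal B}$, product $(f\star g)(x_i/d_i)=f(x_i/d_i)g(x_i/d_i)$ for all $i$, unit $\mu_1$, involution $\mu_{j^\#}(x_i/d_i)=\mu_j(x_{i^*}/\overline{d_i})$. Write $\mu_i\star\mu_j=\sum_k\widehat p_k(i,j)\mu_k$. Grouplike elements of the dual: $G\widehat{(H,\mathcal B,\mu_1)}=\{\mu_j\in\widehat{\mathcal B}:\mu_j\star\mu_{j^\#}=\widehat p_1(j,j^\#)\,\mu_1\}$. That it is a finite group means it is a (finite) group under $\star$. Dual-Burnside: the dual is Burnside, i.e. for every $\mu_j\in\widehat{\mathcal B}$: there is $x_i\in\mathcal B$ with $\mu_j(x_i)=0$ if and only if $\mu_j$ is not grouplike in the dual. Support: let $\widehat F_i\in H^*$ be defined by $\widehat F_i(x_k/d_k)=\delta_{i,k}$; these are the primitive idempotents of $(H^*,\star)$, $\widehat F_i$ corresponding to the character $f\mapsto f(x_i/d_i)$. Let $\lambda$ be the primitive idempotent of the subalgebra of $(H^*,\star)$ spanned by $G\widehat{(H,\mathcal B,\mu_1)}$ corresponding to the character $\mu_j\mapsto1$. Then $\mathcal I_{G\widehat{(H,\mathcal B,\mu_1)}}\subseteq\mathcal I$ is the subset with $\lambda=\sum_{i\in\mathcal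 I_{G\widehat{(H,\mathcal B,\mu_1)}}}\widehat F_i$. *)

(* Defs.v *)
From HB Require Import structures.
From mathcomp Require Import all_boot all_order all_algebra all_field.
From mathcomp Require classical_sets.
From mathcomp Require Import reals.
From mathcomp Require Import complex.

Set Implicit Arguments.
Unset Strict Implicit.
Unset Printing Implicit Defensive.

Import Order.TTheory GRing.Theory Num.Theory.
Local Open Scope ring_scope.

Definition structure_const (F : fieldType) (A : falgType F) (m : nat)
    (x : m.-tuple A) (i j k : 'I_m) : F :=
  coord x k (tnth x i * tnth x j).

(* The rank is hg_n.+1 and the index 1 of the unit is ord0. Conjugation and
   the condition 0 < _ are those of the partially ordered field R[i], where
   0 < z means that z is real and positive. *)
Record hypergroup (R : realType) := Hypergroup {
  hg_alg : falgType (complex R);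
  hg_n : nat;
  hg_basis : hg_n.+1.-tuple hg_alg;
  hg_star : 'I_hg_n.+1 -> 'I_hg_n.+1;
  hg_basisP : basis_of fullv hg_basis;
  hg_unit : tnth hg_basis ord0 = 1;
  hg_starK : involutive hg_star;
  hg_star_gt0 : forall i, 0 < structure_const hg_basis i (hg_star i) ord0;
  hg_star_eq0 : forall i j, j != hg_star i ->
    structure_const hg_basis i j ord0 = 0;
  hg_star_anti : forall i j k,
    structure_const hg_basis (hg_star j) (hg_star i) (hg_star k)
    = (structure_const hg_basis i j k)^*
}.

Definition hg_h (R : realType) (K : hypergroup R) (i : 'I_(hg_n K).+1) :
    complex R :=
  (structure_const (hg_basis K) i (hg_star i) ord0)^-1.

Definition hg_dual (R : realType) (K : hypergroup R) :=
  'Hom(hg_alg K, (complex R)^o).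

(* ahom_in fullv f says that f is multiplicative and unital; nh_chars
   enumerates all such f without repetition, starting with the chosen one. *)
Record abelian_normalizable_hypergroup (R : realType) := NormHypergroup {
  nh_hg :> hypergroup R;
  nh_comm : forall a b : hg_alg nh_hg, a * b = b * a;
  nh_chars : (hg_n nh_hg).+1.-tuple (hg_dual nh_hg);
  nh_chars_uniq : uniq nh_chars;
  nh_charsP : forall f : hg_dual nh_hg,
    (f \in nh_chars) = ahom_in fullv f;
  nh_d_neq0 : forall i,
    (tnth nh_chars ord0 : hg_dual nh_hg) (tnth (hg_basis nh_hg) i) != 0
}.

Definition nh_x (R : realType) (K : abelian_normalizable_hypergroup R)
    (i : 'I_(hg_n K).+1) : hg_alg K := tnth (hg_basis K) i.

Definition nh_mu1 (R : realType) (K : abelian_normalizable_hypergroup R) :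
    hg_dual K := tnth (nh_chars K) ord0.

Definition nh_d (R : realType) (K : abelian_normalizable_hypergroup R)
    (i : 'I_(hg_n K).+1) : complex R := nh_mu1 K (nh_x i).

Definition nh_order (R : realType) (K : abelian_normalizable_hypergroup R) :
    complex R := \sum_(i < (hg_n K).+1) hg_h i * `|nh_d i| ^+ 2.

Definition nh_xd (R : realType) (K : abelian_normalizable_hypergroup R)
    (i : 'I_(hg_n K).+1) : hg_alg K := (nh_d i)^-1 *: nh_x i.

(* The linear form taking the value v i at x_i / d_i; see dual_of_valuesE. *)
Definition dual_of_values (R : realType)
    (K : abelian_normalizable_hypergroup R)
    (v : 'I_(hg_n K).+1 -> complex R) : hg_dual K :=
  linfun (fun a : hg_alg K =>
    \sum_(i < (hg_n K).+1) coord (hg_basis K) i a * nh_d i * v i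
      : (complex R)^o).

Lemma dual_of_valuesE (R : realType) (K : abelian_normalizable_hypergroup R)
    (v : 'I_(hg_n K).+1 -> complex R) (i : 'I_(hg_n K).+1) :
  dual_of_values v (nh_xd i) = v i.
Proof.
pose g (a : hg_alg K) : (complex R)^o :=
  \sum_(i < (hg_n K).+1) coord (hg_basis K) i a * nh_d i * v i.
have g_lin : linear g.
  move=> c a b; rewrite /g scaler_sumr -big_split /=; apply: eq_bigr => j _.
  by rewrite linearP /= !mulrDl -!mulrA.
pose L := GRing.isLinear.Build _ _ _ _ g g_lin.
pose gL : {linear hg_alg K -> (complex R)^o} := HB.pack g L.
rewrite /dual_of_values (lfunE gL) /= /g (bigD1 i) //= big1 => [|j ji].
  rewrite addr0 /nh_xd linearZ /= /nh_x (tnth_nth 0) coord_free.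
    by rewrite eqxx mulr1 mulVf ?mul1r //; apply: nh_d_neq0.
  exact: basis_free (hg_basisP K).
rewrite /nh_xd linearZ /= /nh_x (tnth_nth 0) coord_free.
  by rewrite eq_sym (negbTE ji) mulr0 !mul0r.
exact: basis_free (hg_basisP K).
Qed.

Definition dual_mul (R : realType) (K : abelian_normalizable_hypergroup R)
    (f g : hg_dual K) : hg_dual K :=
  dual_of_values (fun i => f (nh_xd i) * g (nh_xd i)).

(* Only a linear form: f^# need not be in nh_chars K when f is, since the
   structure constants of the x_i / d_i are not assumed to be real. *)
Definition dual_sharp (R : realType) (K : abelian_normalizable_hypergroup R)
    (f : hg_dual K) : hg_dual K :=
  dual_of_values (fun i => f (((nh_d i)^*)^-1 *: nh_x (hg_star i))).

Definition dual_coef1 (R : realType) (K : abelian_normalizable_hypergroup R)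
    (f g : hg_dual K) : complex R :=
  coord (nh_chars K) ord0 (dual_mul f g).

Definition dual_grouplike (R : realType)
    (K : abelian_normalizable_hypergroup R) : seq (hg_dual K) :=
  [seq f <- nh_chars K |
    dual_mul f (dual_sharp f) == dual_coef1 f (dual_sharp f) *: nh_mu1 K].

Definition group_under (T : eqType) (op : T -> T -> T) (S : seq T) : Prop :=
  [/\ {in S &, forall a b, op a b \in S},
      {in S & &, forall a b c, op a (op b c) = op (op a b) c} &
      exists2 e, e \in S &
        {in S, forall a, op e a = a /\ op a e = a} /\
        {in S, forall a, exists2 b, b \in S & op a b = e /\ op b a = e}].

Definition dual_burnside (R : realType)
    (K : abelian_normalizable_hypergroup R) : Prop :=
  forall f, f \in nh_chars K ->
    (exists i : 'I_(hg_n K).+1, f (nh_x i) = 0)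
    <-> f \notin dual_grouplike K.

Definition dual_idem (R : realType) (K : abelian_normalizable_hypergroup R)
    (i : 'I_(hg_n K).+1) : hg_dual K :=
  dual_of_values (fun k => (i == k)%:R).

Definition dual_primitive_idempotent (R : realType)
    (K : abelian_normalizable_hypergroup R) (U : {vspace hg_dual K})
    (e : hg_dual K) : Prop :=
  [/\ e \in U, e != 0, dual_mul e e = e &
      forall a b, a \in U -> b \in U ->
        dual_mul a a = a -> dual_mul b b = b ->
        dual_mul a b = 0 -> dual_mul b a = 0 ->
        e = a + b -> a = 0 \/ b = 0].

(* e spans the line of U on which U acts through the character chi. *)
Definition dual_idempotent_of_char (R : realType)
    (K : abelian_normalizable_hypergroup R) (U : {vspace hg_dual K})
    (chi : hg_dual K -> complex R) (e : hg_dual K) : Prop :=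
  dual_primitive_idempotent U e /\
  forall f, f \in U -> dual_mul f e = chi f *: e.

(* The linear form with value 1 at every mu_j. *)
Definition dual_aug (R : realType) (K : abelian_normalizable_hypergroup R)
    (f : hg_dual K) : complex R :=
  \sum_(j < (hg_n K).+1) coord (nh_chars K) j f.

Definition is_dual_support (R : realType)
    (K : abelian_normalizable_hypergroup R)
    (I : {set 'I_(hg_n K).+1}) : Prop :=
  exists2 lam : hg_dual K,
    dual_idempotent_of_char <<dual_grouplike K>>%VS (@dual_aug R K) lam &
    lam = \sum_(i in I) dual_idem i.

(* When the grouplike elements form a group there is exactly one such set;
   otherwise the value may be the default set0. *)
Definition dual_support (R : realType)
    (K : abelian_normalizable_hypergroup R) : {set 'I_(hg_n K).+1} :=
  classical_sets.xget (@set0 'I_(hg_n K).+1)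
    (fun I : {set 'I_(hg_n K).+1} => is_dual_support I).

(* Main.v *)
(* Both sides are compared through the characters mu_j, which separate the
   points of H because they are orthogonal for the weights h_i.

   Put a_j(i) = mu_j(x_i / d_i), so that mu_j is grouplike if and only if
   |a_j(i)| = 1 for all i. The idempotent lambda is the average of the group of
   grouplike elements, and orthogonality shows that mu_j sends the right-hand
   side to 1 if mu_j is grouplike and to 0 otherwise. It sends the left-hand side
   to (prod_i a_j(i))^2, which vanishes if and only if mu_j has a zero on the
   basis. For mu_j grouplike this square is always 1: since
   a_j(i^* ) is conjugate to a_j(i), it equals prod_i |a_j(i)|^2. *)

Require Import Defs.
From HB Require Import structures.
From mathcomp Require Import all_boot all_order all_algebra all_field.
From mathcomp Require Import reals.
From mathcomp Require Import complex.

Set Implicit Arguments.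
Unset Strict Implicit.
Unset Printing Implicit Defensive.

Import Order.TTheory GRing.Theory Num.Theory.
Local Open Scope ring_scope.

(** * Structure constants and orthogonality of characters *)

Section Hypergroup.
Variables (R : realType) (K : hypergroup R).
Local Notation I := 'I_(hg_n K).+1.
Local Notation N := (structure_const (hg_basis K)).
Local Notation x := (tnth (hg_basis K)).
Local Notation "i ^s" := (hg_star i) (at level 2, format "i ^s").

Lemma hg_basis_free : free (hg_basis K).
Proof. exact: basis_free (hg_basisP K). Qed.

Lemma hg_coord_basis (i k : I) : coord (hg_basis K) k (x i) = (k == i)%:R.
Proof. by rewrite (tnth_nth 0) coord_free ?hg_basis_free // eq_sym. Qed.

Lemma hg_expand (a : hg_alg K) :
  a = \sum_k coord (hg_basis K) k a *: x k.
Proof.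
rewrite {1}(coord_basis (hg_basisP K) (memvf a)).
by apply: eq_bigr => k _; rewrite -tnth_nth.
Qed.

Lemma hg_mulE (i j : I) : x i * x j = \sum_k N i j k *: x k.
Proof. exact: hg_expand. Qed.

(** Otherwise the coefficient of 1 in the product 1 * 1 would vanish. *)
Lemma hg_star0 : hg_star ord0 = ord0 :> I.
Proof.
apply/eqP/contraT; rewrite eq_sym => /hg_star_eq0 /eqP.
by rewrite /structure_const hg_unit mulr1 -hg_unit hg_coord_basis eqxx oner_eq0.
Qed.

Lemma hg_h_gt0 (i : I) : 0 < hg_h i.
Proof. by rewrite invr_gt0; apply: hg_star_gt0. Qed.

Lemma structure_const_dual (i j : I) : N i j^s ord0 = (i == j)%:R / hg_h i.
Proof.
have [<-|ij] := eqVneq i j; first by rewrite mul1r invrK.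
rewrite mul0r hg_star_eq0 // (inj_eq (inv_inj (@hg_starK _ K))) eq_sym //.
Qed.

(** Once [x a * x i] is expanded, only the term at [l] pairs nontrivially with [x l^s]. *)
Lemma structure_const_assoc (a i l : I) :
  coord (hg_basis K) ord0 (x a * x i * x l^s) = N a i l / hg_h l.
Proof.
rewrite hg_mulE mulr_suml linear_sum (bigD1 l) //= big1 => [|k kl].
  rewrite -scalerAl linearZ /= addr0 -[coord _ _ _]/(N l l^s ord0).
  by rewrite structure_const_dual eqxx mul1r.
rewrite -scalerAl linearZ /= -[coord _ _ _]/(N k l^s ord0).
by rewrite structure_const_dual (negbTE kl) mul0r mulr0.
Qed.

(** Characters are recorded by their values on the basis, so that conjugating them and twisting them
    by the star need no linear map. *)
Definition hg_character (u : I -> complex R) : Prop :=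
  u ord0 = 1 /\ forall i j, u i * u j = \sum_k N i j k * u k.

Definition hg_pairing (u v : I -> complex R) : complex R :=
  \sum_i hg_h i * u i * (v i)^*.

Lemma hg_pairing_gt0 (u : I -> complex R) :
  hg_character u -> 0 < hg_pairing u u.
Proof.
case=> u0 _; rewrite /hg_pairing (bigD1 ord0) //= ltr_pwDl //.
  by rewrite u0 conjC1 !mulr1 hg_h_gt0.
apply: sumr_ge0 => i _; rewrite -mulrA -normCK.
by rewrite mulr_ge0 ?exprn_ge0 ?normr_ge0 // ltW ?hg_h_gt0.
Qed.

Hypothesis comm : forall a b : hg_alg K, a * b = b * a.

Lemma hg_h_star (i : I) : hg_h i^s = hg_h i.
Proof. by rewrite /hg_h /structure_const hg_starK comm. Qed.

(** Frobenius reciprocity: the coefficient of 1 in [x a * x i * x l^s] is computed in two ways,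
    multiplying [x a] first by [x i] or first by [x l^s]. *)
Lemma structure_const_frobenius (a i l : I) :
  hg_h i * N a i l = hg_h l * N a l^s i^s.
Proof.
have h0 (j : I) : hg_h j != 0 by rewrite (gt_eqF (hg_h_gt0 j)).
have := structure_const_assoc a i l.
rewrite -mulrA (comm (x i)) mulrA -{1}[ i ]hg_starK.
rewrite structure_const_assoc hg_h_star.
by move/eqP; rewrite eqr_div // => /eqP E; rewrite mulrC -E mulrC.
Qed.

(* The conjugate of [u] twisted by the star is again a character, so pairing it
   with [u] is covered by the algebraic orthogonality below. *)
Lemma hg_character_conj (u : I -> complex R) :
  hg_character u -> hg_character (fun i => (u i^s)^*).
Proof.
case=> u0 uM; split=> [|i j]; first by rewrite hg_star0 u0 conjC1.
rewrite -rmorphM mulrC uM rmorph_sum /= (reindex_inj (inv_inj (@hg_starK _ K))).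
apply: eq_bigr => k _ /=; rewrite rmorphM; congr (_ * _).
by rewrite hg_star_anti; exact: conjCK.
Qed.

(** Let S be the sum. Frobenius reciprocity moves multiplication by [x a] from [u] to [v], so [u a]
    S = [v a] S, and S can be cancelled. *)
Lemma hg_character_orthogonal_star (u v : I -> complex R) :
    hg_character u -> hg_character v ->
  \sum_i hg_h i * u i * v i^s != 0 -> u =1 v.
Proof.
move=> [_ uM] [_ vM] S0 a; apply: (mulIf S0); rewrite !mulr_sumr.
transitivity (\sum_i \sum_l hg_h i * N a i l * u l * v i^s).
  apply: eq_bigr => i _; rewrite mulrA mulrCA uM mulr_sumr mulr_suml.
  by apply: eq_bigr => l _; rewrite !mulrA.
rewrite exchange_big; apply: eq_bigr => l _ /=.
rewrite mulrCA vM mulr_sumr (reindex_inj (inv_inj (@hg_starK _ K))) /=.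
apply: eq_bigr => i _; rewrite structure_const_frobenius !hg_starK.
by rewrite !mulrA; congr (_ * _); rewrite mulrAC.
Qed.

(** The bilinear sum of [u] with its twisted conjugate is [hg_pairing u u], which is positive; hence
    the two characters coincide. *)
Lemma hg_character_star (u : I -> complex R) :
  hg_character u -> forall i, u i^s = (u i)^*.
Proof.
move=> uP i; have := hg_character_orthogonal_star uP (hg_character_conj uP).
rewrite (_ : \sum_i _ = hg_pairing u u).
  by rewrite gt_eqF ?hg_pairing_gt0 // => /(_ isT i) ->; rewrite conjCK.
by apply: eq_bigr => j _; rewrite hg_starK.
Qed.

Lemma hg_character_orthogonal (u v : I -> complex R) :
  hg_character u -> hg_character v -> hg_pairing u v != 0 -> u =1 v.
Proof.
move=> uP vP S0; apply: hg_character_orthogonal_star => //.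
by under eq_bigr do rewrite hg_character_star //.
Qed.

End Hypergroup.

(** * The character table and its inverse *)

Section NormalizableHypergroup.
Variables (R : realType) (K : abelian_normalizable_hypergroup R).
Local Notation C := (complex R).
Local Notation I := 'I_(hg_n K).+1.
Local Notation mu := (tnth (nh_chars K)).
Local Notation G := (dual_grouplike K).

Lemma nh_charM (f : hg_dual K) (a b : hg_alg K) :
  f \in nh_chars K -> f (a * b) = f a * f b.
Proof. by rewrite nh_charsP => /ahom_inP[fM _]; rewrite fM ?memvf. Qed.

Lemma nh_char1 (f : hg_dual K) : f \in nh_chars K -> f 1 = 1.
Proof. by rewrite nh_charsP => /ahom_inP[]. Qed.

Lemma nh_char_prod (f : hg_dual K) (v : I -> hg_alg K) :
  f \in nh_chars K -> f (\prod_i v i) = \prod_i f (v i).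
Proof.
move=> fP; apply: (big_morph f _ (nh_char1 fP)) => a b.
exact: nh_charM.
Qed.

Lemma nh_char_character (f : hg_dual K) :
  f \in nh_chars K -> hg_character (fun i : I => f (nh_x i) : C).
Proof.
move=> fP; split=> [|i j]; first by rewrite /nh_x hg_unit nh_char1.
rewrite -[LHS](nh_charM _ _ fP) /nh_x hg_mulE linear_sum /=.
by apply: eq_bigr => k _; rewrite linearZ.
Qed.

Lemma hg_dual_ext (f g : hg_dual K) :
  (forall i : I, f (nh_x i) = g (nh_x i)) -> f = g.
Proof.
move=> fg; apply/lfunP => a; rewrite (hg_expand a) !linear_sum /=.
by apply: eq_bigr => i _; rewrite !linearZ /=; congr (_ *: _); apply: fg.
Qed.

Lemma nh_dP (i : I) : nh_d i != 0. Proof. exact: nh_d_neq0. Qed.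

Lemma nh_xdE (f : hg_dual K) (i : I) :
  f (nh_xd i) = (nh_d i)^-1 * f (nh_x i) :> C.
Proof. by rewrite /nh_xd linearZ. Qed.

Lemma nh_xE (f : hg_dual K) (i : I) :
  f (nh_x i) = nh_d i * f (nh_xd i) :> C.
Proof. by rewrite nh_xdE mulrA divff ?nh_dP ?mul1r. Qed.

Lemma hg_dual_extd (f g : hg_dual K) :
  (forall i : I, f (nh_xd i) = g (nh_xd i)) -> f = g.
Proof. by move=> fg; apply: hg_dual_ext => i; rewrite !nh_xE fg. Qed.

Lemma nh_pairing (j k : I) :
  hg_pairing (fun i => mu j (nh_x i) : C) (fun i => mu k (nh_x i) : C)
  = (j == k)%:R * hg_pairing (fun i => mu j (nh_x i) : C)
                             (fun i => mu j (nh_x i) : C).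
Proof.
have [<-|jk] := eqVneq; first by rewrite mul1r.
rewrite mul0r; apply/eqP; apply: contraNT jk => S0; apply/eqP.
apply/(tuple_uniqP _ (nh_chars_uniq K)); apply: hg_dual_ext.
by apply: (hg_character_orthogonal (@nh_comm _ K) _ _ S0);
  apply: nh_char_character; apply: mem_tnth.
Qed.

Lemma nh_pairing_neq0 (j : I) :
  hg_pairing (fun i => mu j (nh_x i) : C) (fun i => mu j (nh_x i)) != 0.
Proof.
by rewrite gt_eqF // hg_pairing_gt0 //; apply/nh_char_character/mem_tnth.
Qed.

Definition nh_table : 'M[C]_((hg_n K).+1) := \matrix_(j, i) mu j (nh_x i).

(** The conjugate transpose of the table, with rows weighted by [hg_h] and columns divided by the
    squared norms of the characters. *)
Definition nh_table_inv : 'M[C]_((hg_n K).+1) :=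
  \matrix_(i, k) (hg_h i * (mu k (nh_x i))^*
    / hg_pairing (fun l => mu k (nh_x l) : C) (fun l => mu k (nh_x l))).

Lemma nh_tableV : nh_table *m nh_table_inv = 1%:M.
Proof.
apply/matrixP => j k; rewrite !mxE.
transitivity (hg_pairing (fun i => mu j (nh_x i) : C) (fun i => mu k (nh_x i))
  / hg_pairing (fun i => mu k (nh_x i) : C) (fun i => mu k (nh_x i))).
  rewrite /hg_pairing mulr_suml; apply: eq_bigr => i _; rewrite !mxE.
  by rewrite mulrA mulrCA mulrA.
rewrite nh_pairing; have [<-|_] := eqVneq j k; last by rewrite !mul0r.
by rewrite mul1r divff ?nh_pairing_neq0.
Qed.

Lemma nh_chars_separate (a b : hg_alg K) :
  (forall j : I, mu j a = mu j b) -> a = b.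
Proof.
pose c a : 'cV[C]_((hg_n K).+1) := \col_i coord (hg_basis K) i a.
have cE d : nh_table *m c d = \col_j mu j d.
  apply/colP => j; rewrite !mxE {2}(hg_expand d) linear_sum /=.
  by apply: eq_bigr => i _; rewrite !mxE linearZ mulrC.
move=> ab; have /colP cab : c a = c b.
  (* The table is square, so its right inverse is also a left inverse and recovers the coordinates
     from the character values. *)
  rewrite -[c a]mul1mx -[c b]mul1mx -(mulmx1C nh_tableV) -!mulmxA !cE.
  by congr (_ *m _); apply/colP => j; rewrite !mxE.
rewrite (hg_expand a) (hg_expand b); apply: eq_bigr => i _.
by have := cab i; rewrite !mxE => ->.
Qed.

Lemma nh_chars_free : free (nh_chars K).
Proof.
apply/freeP => k k0 i.
suff /rowP/(_ i) : \row_j k j = 0 :> 'rV[C]_((hg_n K).+1) by rewrite !mxE.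
(* A linear relation between the characters is a row vector killed by the table, hence zero by the
   right inverse. *)
rewrite -[LHS]mulmx1 -nh_tableV mulmxA (_ : _ *m nh_table = 0) ?mul0mx //.
apply/rowP => l; rewrite !mxE.
have /lfunP/(_ (nh_x l)) := k0; rewrite sum_lfunE zero_lfunE => E.
rewrite -[RHS]E; apply: eq_bigr => j _.
by rewrite !mxE scale_lfunE -tnth_nth.
Qed.

Lemma dual_coord_char (j k : I) : coord (nh_chars K) j (mu k) = (j == k)%:R.
Proof. by rewrite (tnth_nth 0) coord_free ?nh_chars_free // eq_sym. Qed.

(** * The product of the dual and the augmentation *)

Lemma dual_mulE (f g : hg_dual K) (i : I) :
  dual_mul f g (nh_xd i) = f (nh_xd i) * g (nh_xd i) :> C.
Proof. exact: dual_of_valuesE. Qed.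

Lemma dual_mulZr (c : C) (f g : hg_dual K) :
  dual_mul f (c *: g) = c *: dual_mul f g.
Proof.
apply: hg_dual_extd => i.
by rewrite dual_mulE !scale_lfunE dual_mulE; apply: mulrCA.
Qed.

Lemma dual_mulC (f g : hg_dual K) : dual_mul f g = dual_mul g f.
Proof. by apply: hg_dual_extd => i; rewrite !dual_mulE mulrC. Qed.

Lemma dual_mulDr (f g h : hg_dual K) :
  dual_mul f (g + h) = dual_mul f g + dual_mul f h.
Proof.
apply: hg_dual_extd => i.
by rewrite dual_mulE !add_lfunE !dual_mulE; apply: mulrDr.
Qed.

Lemma dual_mul0r (f : hg_dual K) : dual_mul f 0 = 0.
Proof. by have := dual_mulZr 0 f 0; rewrite !scale0r. Qed.

Lemma dual_mul_sumr (T : Type) (r : seq T) (f : hg_dual K)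
    (g : T -> hg_dual K) :
  dual_mul f (\sum_(t <- r) g t) = \sum_(t <- r) dual_mul f (g t).
Proof. exact: (big_morph _ (dual_mulDr f) (dual_mul0r f)). Qed.

Lemma dual_aug_sum (T : Type) (r : seq T) (c : T -> C) (f : T -> hg_dual K) :
  dual_aug (\sum_(t <- r) c t *: f t) = \sum_(t <- r) c t * dual_aug (f t).
Proof.
rewrite /dual_aug; under eq_bigr do rewrite linear_sum.
rewrite exchange_big; apply: eq_bigr => t _ /=; rewrite mulr_sumr.
by apply: eq_bigr => j _; rewrite linearZ.
Qed.

Lemma dual_aug_char (f : hg_dual K) : f \in nh_chars K -> dual_aug f = 1.
Proof.
case/tnthP=> k ->; rewrite /dual_aug (bigD1 k) //= big1 => [|j /negbTE jk].
  by rewrite dual_coord_char eqxx addr0.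
by rewrite dual_coord_char jk.
Qed.

(** * Values at the normalized basis and grouplike elements *)

Lemma nh_mu1_xd (i : I) : nh_mu1 K (nh_xd i) = 1 :> C.
Proof. by rewrite nh_xdE mulVf ?nh_dP. Qed.

Lemma nh_mu1_char : nh_mu1 K \in nh_chars K. Proof. exact: mem_tnth. Qed.

Lemma nh_xd0 : nh_xd ord0 = 1 :> hg_alg K.
Proof.
rewrite /nh_xd /nh_d /nh_x hg_unit nh_char1 ?nh_mu1_char //.
by rewrite invr1 scale1r.
Qed.

Lemma nh_char_star (f : hg_dual K) (i : I) :
  f \in nh_chars K -> f (nh_x (hg_star i)) = (f (nh_x i) : C)^*.
Proof.
move=> fP.
exact: (hg_character_star (@nh_comm _ K) (nh_char_character fP) i).
Qed.

Lemma nh_d_star (i : I) : nh_d (hg_star i) = (nh_d i)^*.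
Proof. exact/nh_char_star/nh_mu1_char. Qed.

Lemma nh_char_xd_star (f : hg_dual K) (i : I) :
  f \in nh_chars K -> f (nh_xd (hg_star i)) = (f (nh_xd i) : C)^*.
Proof.
by move=> fP; rewrite !nh_xdE nh_d_star nh_char_star // rmorphM fmorphV.
Qed.

Lemma dual_sharp_char (f : hg_dual K) (i : I) :
  f \in nh_chars K -> dual_sharp f (nh_xd i) = (f (nh_xd i) : C)^*.
Proof.
move=> fP; rewrite -nh_char_xd_star // /nh_xd nh_d_star.
exact: dual_of_valuesE.
Qed.

Lemma dual_grouplike_char (f : hg_dual K) : f \in G -> f \in nh_chars K.
Proof. by rewrite mem_filter => /andP[]. Qed.

(** The product of [f] and [dual_sharp f] has value |f(x_i/d_i)|^2 at x_i/d_i, while [nh_mu1 K] is 1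
    there. So [f] is grouplike exactly when these moduli are constant. *)
Lemma dual_grouplikeP (f : hg_dual K) : f \in nh_chars K ->
  reflect (forall i : I, `|f (nh_xd i) : C| = 1) (f \in G).
Proof.
move=> fP; rewrite mem_filter fP andbT; apply: (iffP eqP) => [E i|f1].
  have {}E j : `|f (nh_xd j) : C| ^+ 2 = dual_coef1 f (dual_sharp f).
    have /lfunP/(_ (nh_xd j)) := E.
    rewrite dual_mulE dual_sharp_char // -normCK scale_lfunE nh_mu1_xd => ->.
    exact: mulr1.
  apply/eqP; rewrite -(@eqrXn2 _ 2) ?normr_ge0 ?ler01 //; apply/eqP.
  (* The constant is read off at the unit, where [f] is 1. *)
  by rewrite E -(E ord0) nh_xd0 nh_char1 // normr1.
have E : dual_mul f (dual_sharp f) = nh_mu1 K.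
  apply: hg_dual_extd => i; rewrite dual_mulE dual_sharp_char // -normCK f1.
  by rewrite nh_mu1_xd expr1n.
by rewrite /dual_coef1 E /nh_mu1 dual_coord_char eqxx scale1r.
Qed.

Lemma dual_grouplike_pairing (f : hg_dual K) : f \in G ->
  hg_pairing (fun i => f (nh_x i) : C) (fun i => f (nh_x i)) = nh_order K.
Proof.
move=> fG; have fP := dual_grouplike_char fG.
apply: eq_bigr => i _; rewrite -mulrA -normCK nh_xE normrM.
by rewrite (dual_grouplikeP fP fG) mulr1.
Qed.

Lemma nh_order_gt0 : 0 < nh_order K.
Proof.
rewrite -(@dual_grouplike_pairing (nh_mu1 K)).
  by apply/hg_pairing_gt0/nh_char_character/nh_mu1_char.
by apply/dual_grouplikeP => [|i]; rewrite ?nh_mu1_char // nh_mu1_xd normr1.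
Qed.

(** The other implication always holds: the values of a grouplike element at the x_i/d_i have
    modulus 1, so it has no zero on the basis. *)
Lemma dual_burnsideP : dual_burnside K <->
  (forall f, f \in nh_chars K -> f \notin G -> exists i : I, f (nh_x i) = 0).
Proof.
split=> B f fP; first by case: (B f fP).
split=> [[i fi0]|]; last exact: B.
apply/negP => /(dual_grouplikeP fP)/(_ i)/eqP.
by rewrite nh_xdE fi0 mulr0 normr0 eq_sym oner_eq0.
Qed.

(* The star involution exchanges the factors with their conjugates. *)
Lemma dual_grouplike_prod (f : hg_dual K) : f \in G ->
  (\prod_(i : I) (f (nh_xd i) : C)) ^+ 2 = 1.
Proof.
move=> fG; have fP := dual_grouplike_char fG.
rewrite expr2 {2}(reindex_inj (inv_inj (@hg_starK _ K))) -big_split.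
rewrite big1 //= => i _.
by rewrite nh_char_xd_star // -normCK (dual_grouplikeP fP fG) expr1n.
Qed.

(** * The averaging idempotent and its support *)

Section Group.
Hypothesis hG : group_under (@dual_mul R K) G.

Definition dual_avg : hg_dual K := (size G)%:R^-1 *: \sum_(g <- G) g.

Lemma dual_grouplike_size : (size G)%:R != 0 :> C.
Proof. by case: hG => _ _ [e eG _]; rewrite pnatr_eq0; case: G eG. Qed.

Lemma dual_avg_span : dual_avg \in <<G>>%VS.
Proof. by rewrite memvZ // big_seq memv_suml // => g gG; apply: memv_span. Qed.

Lemma dual_avg_aug : dual_aug dual_avg = 1.
Proof.
rewrite /dual_avg scaler_sumr dual_aug_sum -mulr_sumr big_seq.
rewrite (eq_bigr (fun=> 1)) => [|g /dual_grouplike_char gP].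
  rewrite -big_seq big_const_seq count_predT iter_addr addr0.
  by rewrite mulVf ?dual_grouplike_size.
exact: dual_aug_char.
Qed.

(** Multiplication by [g] is injective, since [g] vanishes at no x_i/d_i, and it maps the finite set
    [G] to itself; so it permutes the terms of the average. *)
Lemma dual_mul_avg_grouplike (g : hg_dual K) :
  g \in G -> dual_mul g dual_avg = dual_avg.
Proof.
move=> gG; have gP := dual_grouplike_char gG.
have g0 i : g (nh_xd i) != 0.
  by rewrite -normr_eq0 (dual_grouplikeP gP gG) oner_eq0.
have inj : injective (dual_mul g).
  move=> f h E; apply: hg_dual_extd => i; apply: (mulfI (g0 i)).
  by rewrite -!dual_mulE E.
have uG : uniq G by rewrite filter_uniq ?nh_chars_uniq.
rewrite /dual_avg dual_mulZr dual_mul_sumr -(big_map (dual_mul g) xpredT id).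
congr (_ *: _); apply: perm_big; apply: uniq_perm => //.
  by rewrite map_inj_uniq.
apply: (uniq_min_size _ _ _).2; rewrite ?map_inj_uniq ?size_map //.
by case: hG => GM _ _ _ /mapP[f fG ->]; apply: GM.
Qed.

Lemma dual_mul_avg (f : hg_dual K) :
  f \in <<G>>%VS -> dual_mul f dual_avg = dual_aug f *: dual_avg.
Proof.
move=> /(@coord_span _ _ _ (in_tuple G)) ->.
rewrite dual_aug_sum scaler_suml dual_mulC dual_mul_sumr.
apply: eq_bigr => i _; rewrite dual_mulZr dual_mulC.
have gG : (in_tuple G)`_i \in G by rewrite mem_nth.
by rewrite dual_mul_avg_grouplike // dual_aug_char ?mulr1 ?dual_grouplike_char.
Qed.

Lemma dual_avg_idem : dual_mul dual_avg dual_avg = dual_avg.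
Proof. by rewrite dual_mul_avg ?dual_avg_span // dual_avg_aug scale1r. Qed.

Lemma dual_avg_neq0 : dual_avg != 0.
Proof.
apply: contra_eq_neq dual_avg_aug => ->.
(* Zero is written as an empty combination, so that [dual_aug_sum] evaluates its augmentation. *)
rewrite -(big_nil 0 +%R xpredT (fun f => 0 *: f)) dual_aug_sum big_nil.
by rewrite eq_sym oner_neq0.
Qed.

Lemma dual_idem_scale_avg (c : C) :
  dual_mul (c *: dual_avg) (c *: dual_avg) = c *: dual_avg -> c = 0 \/ c = 1.
Proof.
rewrite dual_mulZr dual_mulC dual_mulZr dual_avg_idem scalerA => /eqP.
rewrite -subr_eq0 -scalerBl scaler_eq0 (negbTE dual_avg_neq0) orbF.
rewrite -{3}[c]mulr1 -mulrBr mulf_eq0 subr_eq0.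
by case/orP=> /eqP; [left | right].
Qed.

(** For primitivity: if [dual_avg] is a sum of orthogonal idempotents [a] and [b], then [a] equals
    its product with [dual_avg], hence is a scalar multiple of [dual_avg], and the scalar is 0 or
    1. *)
Lemma dual_avg_idempotent_of_char :
  dual_idempotent_of_char <<G>>%VS (@dual_aug R K) dual_avg.
Proof.
split=> [|f]; last exact: dual_mul_avg.
split; rewrite ?dual_avg_span ?dual_avg_neq0 ?dual_avg_idem //.
move=> a b aG bG aa bb ab ba E.
have aE : a = dual_aug a *: dual_avg.
  by rewrite -dual_mul_avg // E dual_mulDr aa ab addr0.
have [a0|a1] : dual_aug a = 0 \/ dual_aug a = 1.
  by apply: dual_idem_scale_avg; rewrite -aE.
  by left; rewrite aE a0 scale0r.
right; apply: (addrI a); rewrite -E addr0.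
by rewrite aE a1 scale1r.
Qed.

(** The product of [lam] and [dual_avg] is [lam] by the property of [lam], and [dual_aug lam] times
    [dual_avg] by that of [dual_avg]. *)
Lemma dual_idempotent_of_char_unique (lam : hg_dual K) :
  dual_idempotent_of_char <<G>>%VS (@dual_aug R K) lam -> lam = dual_avg.
Proof.
case=> -[lamG lam0 lamI _] lamP.
have := lamP _ dual_avg_span; rewrite dual_avg_aug scale1r dual_mulC.
rewrite dual_mul_avg // => E; rewrite -E.
have [c0|->] : dual_aug lam = 0 \/ dual_aug lam = 1; last exact: scale1r.
  by apply: dual_idem_scale_avg; rewrite E.
by move: lam0; rewrite -E c0 scale0r eqxx.
Qed.

Lemma dual_idem_sumE (J : {set I}) (i : I) :
  (\sum_(j in J) dual_idem j) (nh_xd i) = (i \in J)%:R :> C.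
Proof.
rewrite sum_lfunE (eq_bigr (fun j => (j == i)%:R : C)) => [|j _]; last first.
  exact: dual_of_valuesE.
have [iJ|iJ] := boolP (i \in J).
  by rewrite (bigD1 i) //= eqxx big1 ?addr0 // => j /andP[_ /negbTE ->].
by rewrite big1 // => j jJ; case: eqP => // ji; rewrite -ji jJ in iJ.
Qed.

Lemma dual_avg_support (i : I) :
  dual_avg (nh_xd i) = (i \in dual_support K)%:R :> C.
Proof.
have [lam lamP lamE] : is_dual_support (dual_support K).
  (* A support must be exhibited to exclude the default [set0]. The idempotent [dual_avg] takes only
     the values 0 and 1, so the indices with value 1 form one. *)
  apply: (@classical_sets.xgetPex _ set0 (@is_dual_support R K)).
  exists [set i | dual_avg (nh_xd i) == 1]; exists dual_avg.
    exact: dual_avg_idempotent_of_char.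
  apply: hg_dual_extd => j; rewrite dual_idem_sumE inE.
  have /eqP := dual_mulE dual_avg dual_avg j.
  rewrite dual_avg_idem -subr_eq0 -{1}[dual_avg _]mulr1 -mulrBr mulf_eq0.
  case/orP=> [/eqP ->|]; first by rewrite eq_sym oner_eq0.
    by rewrite subr_eq0 => /eqP ->; rewrite eqxx.
by rewrite -(dual_idempotent_of_char_unique lamP) lamE dual_idem_sumE.
Qed.

(** * Evaluation of both sides at the characters *)

Lemma dual_grouplike_orthogonal (f g : hg_dual K) :
  f \in nh_chars K -> g \in G ->
  hg_pairing (fun i => f (nh_x i) : C) (fun i => g (nh_x i))
  = (f == g)%:R * nh_order K.
Proof.
move=> fP gG; have [->|fg] := eqVneq.
  by rewrite mul1r dual_grouplike_pairing.
case/tnthP: fP fg => j ->; case/tnthP: (dual_grouplike_char gG) => k ->.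
by move=> jk; rewrite nh_pairing (negbTE (contra_neq _ jk)) ?mul0r // => ->.
Qed.

Lemma nh_char_support_sum (f : hg_dual K) : f \in nh_chars K ->
  f (((size G)%:R / nh_order K) *:
     \sum_(i in dual_support K) (hg_h i * nh_d (hg_star i)) *: nh_x i)
  = (f \in G)%:R :> C.
Proof.
move=> fP; rewrite linearZ linear_sum /=.
(* The conjugate of [dual_avg] at x_i is the conjugate of d_i, that is [nh_d (hg_star i)], on the
   support, and 0 elsewhere. *)
have -> : \sum_(i in dual_support K) f ((hg_h i * nh_d (hg_star i)) *: nh_x i)
    = hg_pairing (fun i => f (nh_x i) : C) (fun i => dual_avg (nh_x i)).
  rewrite big_mkcond; apply: eq_bigr => i _ /=.
  rewrite (nh_xE dual_avg) dual_avg_support; case: ifP => _.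
    by rewrite mulr1 linearZ nh_d_star /= -[LHS]mulrAC.
  by rewrite mulr0 conjC0 mulr0.
have -> : hg_pairing (fun i => f (nh_x i) : C) (fun i => dual_avg (nh_x i))
    = (size G)%:R^-1 * \sum_(g <- G)
      hg_pairing (fun i => f (nh_x i) : C) (fun i => g (nh_x i)).
  rewrite exchange_big mulr_sumr; apply: eq_bigr => i _ /=.
  rewrite -mulr_sumr scale_lfunE sum_lfunE rmorphM rmorph_sum /=.
  by rewrite fmorphV rmorph_nat mulrCA.
have uG : uniq G by rewrite filter_uniq ?nh_chars_uniq.
have n0 : nh_order K != 0 by rewrite gt_eqF ?nh_order_gt0.
have -> : \sum_(g <- G)
      hg_pairing (fun i => f (nh_x i) : C) (fun i => g (nh_x i))
    = (f \in G)%:R * nh_order K.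
  rewrite big_seq (eq_bigr (fun g => (f == g)%:R * nh_order K)) => [|g gG].
    rewrite -big_seq -mulr_suml; congr (_ * _).
    have [fG|fG] := boolP (f \in G).
      rewrite (bigD1_seq f) //= eqxx big1 ?addr0 // => g.
      by rewrite eq_sym => /negbTE ->.
    by rewrite big_seq big1 // => g gG; case: eqP => // E; rewrite E gG in fG.
  exact: dual_grouplike_orthogonal.
rewrite /GRing.scale /= mulrACA mulfV ?dual_grouplike_size // mul1r.
by rewrite mulrC mulfK.
Qed.

Lemma dual_burnside_prod_eq : dual_burnside K <->
  (\prod_(i : I) nh_xd i) ^+ 2
  = ((size G)%:R / nh_order K) *:
    \sum_(i in dual_support K) (hg_h i * nh_d (hg_star i)) *: nh_x i.
Proof.
have prodE (f : hg_dual K) : f \in nh_chars K ->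
    f ((\prod_(i : I) nh_xd i) ^+ 2) = (\prod_(i : I) (f (nh_xd i) : C)) ^+ 2.
  by move=> fP; rewrite !expr2 nh_charM // nh_char_prod.
rewrite dual_burnsideP; split=> [B|E f fP fG].
  apply: nh_chars_separate => j; have fP := mem_tnth j (nh_chars K).
  rewrite prodE // nh_char_support_sum //.
  have [fG|/(B _ fP)[i fi0]] := boolP (mu j \in G).
    exact: dual_grouplike_prod.
  by rewrite (bigD1 i) //= nh_xdE fi0 mulr0 mul0r expr0n.
(* The right-hand side is sent to 0 by a character outside [G], so one factor of the product on the
   left must vanish. *)
have := nh_char_support_sum fP; rewrite -E prodE // (negbTE fG).
move=> /eqP; rewrite sqrf_eq0 => /prodf_eq0[i _ fi0].
exists i; apply/eqP; move: fi0.
by rewrite nh_xdE mulf_eq0 invr_eq0 (negbTE (nh_dP i)).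
Qed.

End Group.

End NormalizableHypergroup.

Theorem theorem1p10 (R : realType) (K : abelian_normalizable_hypergroup R)
    (hG : group_under (@dual_mul R K) (dual_grouplike K)) :
  dual_burnside K <->
  (\prod_(i < (hg_n K).+1) nh_xd i) ^+ 2
  = ((size (dual_grouplike K))%:R / nh_order K) *:
    \sum_(i in dual_support K) (hg_h i * nh_d (hg_star i)) *: nh_x i.
Proof. exact: dual_burnside_prod_eq. Qed.
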